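(* Let $(\mathcal N,\mathcal M,(v_i)_{i\in\mathcal N},(b_i)_{i\in\mathcal N})$ be a fair division instance with $\mathcal N=[n]$, $\mathcal M=[m]$, monotone valuations $v_i:2^{\mathcal M}\to\mathbb R_{\ge0}$, and entitlements $b_i>0$ with $\sum_ib_i=1$. Then for every agent $i\in\mathcal N$, $$\mathsf{APS}_i=\sup\{z\ge 0:\ (v_{i\downarrow z})^+(b_i,b_i,\dots,b_i)=z\}.$$
   Context: Any price share: $\mathsf{APS}_i=\min_{p}\max_{S\subseteq\mathcal M:\ \sum_{j\in S}p_j\le b_i}v_i(S)$, the minimum over $p\in\mathbb R_{\ge0}^m$ with $\sum_jp_j=1$. Truncation: for a set function $f:2^{V}\to\mathbb R_{\ge 0}$ and $\gamma\ge0$, $f_{\downarrow\gamma}(A)=\min\{f(A),\gamma\}$ for all $A\subseteq V$. Concave extension of $f:2^V\to\mathbb R_{\ge0}$: for $x\in[0,1]^V$, $f^+(x)=\max\{\sum_{S\subseteq V}\alpha_Sf(S):\ \sum_{S\subseteq V}\alpha_S=1,\ \sum_{S\ni e}\alpha_S=x_e\ \forall e\in V,\ \alpha_S\ge0\ \forall S\subseteq V\}$. *)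

(* Defs.v *)
From mathcomp Require Import all_boot all_order all_algebra.
From mathcomp Require Import all_classical all_reals all_analysis.
From mathcomp Require Import lra.

Set Implicit Arguments.
Unset Strict Implicit.
Unset Printing Implicit Defensive.

Import Order.TTheory GRing.Theory Num.Theory.
Import numFieldNormedType.Exports.

Local Open Scope classical_set_scope.
Local Open Scope ring_scope.

Section Defs.
Variables (R : realType) (V : finType).

Definition truncation (f : {set V} -> R) (gamma : R) : {set V} -> R :=
  fun A => Num.min (f A) gamma.

Definition weights (x : V -> R) : set ({set V} -> R) :=
  [set alpha | [/\ \sum_(S : {set V}) alpha S = 1,
                   forall e, \sum_(S : {set V} | e \in S) alpha S = x e &
                   forall S, 0 <= alpha S]].

(* For x in the unit cube the supremum is a maximum: see
   [concave_extension_max]. *)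
Definition concave_extension (f : {set V} -> R) (x : V -> R) : R :=
  sup [set \sum_(S : {set V}) alpha S * f S | alpha in weights x].

Definition prices : set (V -> R) :=
  [set p | (forall j, 0 <= p j) /\ \sum_j p j = 1].

(* The default value 0 of the maximum is harmless: valuations are nonnegative,
   and the empty bundle is affordable for any budget c >= 0. *)
Definition best_affordable (v : {set V} -> R) (c : R) (p : V -> R) : R :=
  \big[Num.max/0]_(S : {set V} | \sum_(j in S) p j <= c) v S.

(* For nonnegative v, c >= 0 and V nonempty the infimum is a minimum: see [APS_min]. *)
Definition APS (v : {set V} -> R) (c : R) : R :=
  inf [set best_affordable v c p | p in prices].

Lemma weights_nonempty (x : V -> R) :
  (forall e, 0 <= x e <= 1) -> weights x !=set0.
Proof.
move=> x01; exists (fun S : {set V} => \prod_e (if e \in S then x e else 1 - x e)).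
split.
- rewrite -(bigA_distr _ _ x (fun e => 1 - x e)) big1// => e _; exact: subrKC.
- move=> e.
  pose G e' := if e' == e then 0 else 1 - x e'.
  transitivity (\sum_(S : {set V}) \prod_e' (if e' \in S then x e' else G e')).
    rewrite big_mkcond/=; apply: eq_bigr => S _; case: ifPn => eS.
      apply: eq_bigr => e' _; case: ifPn => // e'S; rewrite /G.
      by case: eqP => // e'e; rewrite e'e eS in e'S.
    by rewrite (bigD1 e)//= (negbTE eS) /G eqxx mul0r.
  rewrite -(bigA_distr _ _ x G) (bigD1 e)//= /G eqxx addr0 big1 ?mulr1// => e'.
  by move=> /negbTE ->; exact: subrKC.
- move=> S; apply: prodr_ge0 => e _; have := x01 e.
  by case: ifP => _; lra.
Qed.

Lemma weights_le1 (x : V -> R) alpha S : weights x alpha -> 0 <= alpha S <= 1.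
Proof.
move=> [a1 _ a0]; rewrite a0/= -a1 (bigD1 S)//= lerDl.
by apply: sumr_ge0 => T _; exact: a0.
Qed.

Let sum_continuous_gen (T : topologicalType) (I : finType) (P : pred I)
    (F : I -> T -> R) (w : I -> R) : (forall i, continuous (F i)) ->
  continuous (fun a => \sum_(i | P i) F i a * w i).
Proof.
move=> Fc; elim: (index_enum I) => [|i s IHs].
  have -> : (fun a => \sum_(i <- [::] | P i) F i a * w i) = cst 0.
    by apply/funext => a; rewrite big_nil.
  exact: cst_continuous.
have -> : (fun a => \sum_(j <- i :: s | P j) F j a * w j) =
  (fun a => (if P i then F i a * w i else 0) +
            \sum_(j <- s | P j) F j a * w j).
  by apply/funext => a; rewrite big_cons; case: ifP => //; rewrite add0r.
move=> a; apply: cvgD; last exact: IHs.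
case: ifP => _; last exact: cvg_cst.
by apply: cvgM; [exact: Fc|exact: cvg_cst].
Qed.

Local Notation Wspace :=
  (prod_topology (fun _ : {set V} => (R : topologicalType))).

Let sum_continuous (P : pred {set V}) (w : {set V} -> R) :
  continuous (fun alpha : Wspace =>
    \sum_(S : {set V} | P S) alpha S * w S : R).
Proof.
apply: (@sum_continuous_gen _ _ _
  (fun S (alpha : Wspace) => alpha S)).
move=> S.
exact: (@proj_continuous _ (fun _ : {set V} => (R : topologicalType)) S).
Qed.

Lemma weights_compact (x : V -> R) :
  compact (weights x : set Wspace).
Proof.
have cK : compact ([set g : Wspace | forall S, `[0%R, 1%R]%classic (g S)]).
  exact: (@tychonoff {set V} (fun _ => (R : topologicalType))
    (fun _ => `[0%R, 1%R]%classic) (fun _ => @segment_compact R 0 1)).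
apply: (subclosed_compact _ cK); last first.
  by move=> a xa S /=; rewrite in_itv/=; exact: weights_le1 xa.
have -> : (weights x : set Wspace) =
  [set a : Wspace | \sum_(S : {set V} | true) a S * 1 = 1] `&`
  (\bigcap_e [set a : Wspace | \sum_(S : {set V} | e \in S) a S * 1 = x e] `&`
   \bigcap_S [set a : Wspace | 0 <= a S]).
  have E (P : pred {set V}) (a : Wspace) :
      \sum_(S : {set V} | P S) a S * 1 = \sum_(S | P S) a S.
    by apply: eq_bigr => S _; rewrite mulr1.
  apply/seteqP; split => a /=.
    move=> [a1 ax a0]; split; first by rewrite (E xpredT).
    split => [e _|S _]; last exact: a0.
    by apply: etrans (ax e); exact: (E (fun S => e \in S)).
  move=> [a1 [ax a0]]; split; [by rewrite -(E xpredT)| |by move=> S; exact: a0].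
  by move=> e; rewrite -(ax e I); apply: esym; exact: (E (fun S => e \in S)).
apply: closedI; [|apply: closedI].
- apply: (@preimage_closed _ _ _ [set 1 : R]); last exact: closed_eq.
  by move=> a _; exact: sum_continuous.
- apply: closed_bigI => e _.
  apply: (@preimage_closed _ _ _ [set x e]); last exact: closed_eq.
  by move=> a _; exact: (@sum_continuous (fun S => e \in S)).
- apply: closed_bigI => S _; apply: (@preimage_closed _ _ _ [set y : R | 0 <= y]).
    move=> a _.
    exact: (@proj_continuous _ (fun _ : {set V} => (R : topologicalType)) S a).
  exact: closed_ge.
Qed.

Lemma concave_extension_max (f : {set V} -> R) (x : V -> R) :
  (forall e, 0 <= x e <= 1) ->
  exists2 alpha, weights x alpha &
    concave_extension f x = \sum_(S : {set V}) alpha S * f S /\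
    forall beta, weights x beta ->
      \sum_(S : {set V}) beta S * f S <= \sum_(S : {set V}) alpha S * f S.
Proof.
move=> x01.
have [alpha /set_mem xalpha amax] := @compact_EVT_max Wspace R
  _ (weights x) (weights_nonempty x01) (@weights_compact x)
  (continuous_subspaceT (@sum_continuous xpredT f)).
exists alpha => //.
have amax' beta : weights x beta ->
    \sum_(S : {set V}) beta S * f S <= \sum_(S : {set V}) alpha S * f S.
  by move=> /mem_set; exact: amax.
split => //; apply/eqP; rewrite eq_le; apply/andP; split.
  apply: ge_sup; first by exists (\sum_S alpha S * f S), alpha.
  by move=> _ [beta xbeta <-]; exact: amax'.
apply: ub_le_sup; last by exists alpha.
by exists (\sum_S alpha S * f S) => _ [beta xbeta <-]; exact: amax'.
Qed.

Lemma APS_min (v : {set V} -> R) (c : R) :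
  (0 < #|V|)%N -> 0 <= c -> (forall S, 0 <= v S) ->
  exists2 p, prices p & APS v c = best_affordable v c p /\
    forall q, prices q -> best_affordable v c p <= best_affordable v c q.
Proof.
move=> /card_gt0P[j0 _] c0 v0.
have best p : exists S, best_affordable v c p = v S.
  have s0 : \sum_(j in @finset.set0 V) p j <= c by rewrite big_set0.
  rewrite /best_affordable; have [S _ ->] := @eq_bigmax _ _ _ _ (@finset.set0 V)
    (fun S : {set V} => \sum_(j in S) p j <= c) v s0 (fun S _ => v0 S).
  by exists S.
have p0 : prices (fun j => (j == j0)%:R).
  split => [j|]; first exact: ler0n.
  by rewrite (bigD1 j0)//= eqxx big1 ?addr0// => j /negbTE ->.
pose P S := `[< exists2 p, prices p & best_affordable v c p = v S >].
have [S0 S0E] := best (fun j => (j == j0)%:R).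
have PS0 : P S0 by apply/asboolP; exists (fun j => (j == j0)%:R).
case: (arg_minP v PS0) => S /asboolP[p pp pS] Smin.
have pmin q : prices q -> best_affordable v c p <= best_affordable v c q.
  move=> qq; have [T qT] := best q; rewrite pS qT; apply: Smin.
  by apply/asboolP; exists q.
exists p => //; split => //; apply/eqP; rewrite eq_le; apply/andP; split.
  apply: ge_inf; last by exists p.
  by exists (best_affordable v c p) => _ [q qq <-]; exact: pmin.
apply: lb_le_inf; first by exists (best_affordable v c p), p.
by move=> _ [q qq <-]; exact: pmin.
Qed.

Lemma has_sup_truncation_levels (f : {set V} -> R) (x : V -> R) :
  (forall S, 0 <= f S) -> (forall e, 0 <= x e <= 1) ->
  has_sup [set z | 0 <= z /\ concave_extension (truncation f z) x = z].
Proof.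
move=> f0 x01; split.
  exists 0; split => //.
  have [a _ [-> _]] := concave_extension_max (truncation f 0) x01.
  by rewrite big1// => S _; rewrite /truncation min_r// mulr0.
exists (\sum_(S : {set V}) f S) => z [_].
have [a xa [-> _] <-] := concave_extension_max (truncation f z) x01.
apply: ler_sum => S _; have /andP[a0 a1] := weights_le1 S xa.
apply: (@le_trans _ _ (a S * f S)).
  by rewrite ler_wpM2l// /truncation ge_min lexx.
by rewrite ler_piMl.
Qed.

End Defs.

(* Main.v *)
(* A level z satisfies (v_{|z})^+(c, ..., c) = z exactly when some distribution
   over the bundles worth at least z contains every item with probability c.
   Under such a distribution a random bundle costs c on average for any prices,
   so some bundle worth at least z is affordable and APS >= z.
   Conversely, if no such distribution exists for z = APS, a vector q strictly
   separates (c, ..., c) from the indicators of the bundles worth at least z;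
   these are upward closed and c <= 1, so the normalized positive part of q
   is a price vector at which each of them costs more than c. *)
Require Import Defs.
From mathcomp Require Import all_boot all_order all_algebra.
From mathcomp Require Import all_classical all_reals all_analysis.
From mathcomp Require Import ring lra.

Import Order.TTheory GRing.Theory Num.Theory.
Import numFieldNormedType.Exports.
Local Open Scope classical_set_scope.
Local Open Scope ring_scope.

(** * Compactness of the simplex of distributions with prescribed support *)

Local Notation fun_space I R :=
  (prod_topology (fun _ : I => (R : topologicalType))).

(** Points are total functions vanishing off [P], not functions on a subtype, so that they live in a
    product space where Tychonoff applies. *)
Definition simplex_on (R : realType) (I : finType) (P : pred I) :
    set (I -> R) :=
  [set a | [/\ forall i, 0 <= a i, forall i, ~~ P i -> a i = 0 &
               \sum_i a i = 1]].

Lemma continuous_lin_comb (R : realType) (I : finType) (w : I -> R) :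
  continuous (fun a : fun_space I R => \sum_i a i * w i : R).
Proof.
suff gen (T : topologicalType) (F : I -> T -> R) :
    (forall i, continuous (F i)) -> continuous (fun a => \sum_i F i a * w i).
  apply: (gen _ (fun i (a : fun_space I R) => a i)).
  move=> i.
  exact: (@proj_continuous I (fun _ => (R : topologicalType)) i).
move=> F_cont; apply: continuous_big => [|i _]; first exact: add_continuous.
by move=> a; apply: cvgM; [exact: F_cont|exact: cvg_cst].
Qed.

Lemma simplex_on_compact (R : realType) (I : finType) (P : pred I) :
  compact (simplex_on R I P : set (fun_space I R)).
Proof.
have cK := @tychonoff I (fun _ => (R : topologicalType))
    (fun _ => `[0%R, 1%R]%classic) (fun _ => @segment_compact R 0 1).
apply: (subclosed_compact _ cK); last first.
  move=> a [a0 _ a1] i /=; rewrite in_itv/= a0/= -a1 (bigD1 i)//= lerDl.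
  by apply: sumr_ge0 => j _; exact: a0.
have proj_cont i := @proj_continuous I (fun _ => (R : topologicalType)) i.
have -> : (simplex_on R I P : set (fun_space I R)) =
  (\bigcap_i proj i @^-1` [set y : R | 0 <= y]) `&`
  ((\bigcap_(i in [set i | ~~ P i]) proj i @^-1` [set 0 : R]) `&`
   (fun a => \sum_i a i * 1 : R) @^-1` [set 1]).
  have E (a : I -> R) : \sum_i a i * 1 = \sum_i a i.
    by apply: eq_bigr => i _; rewrite mulr1.
  apply/seteqP; split => a /=.
    move=> [a0 aP a1]; split=> [i _|]; [exact: a0|].
    by split=> [i|]; [exact: aP|rewrite E].
  by move=> [a0 [aP a1]]; split=> [i|i|]; [exact: a0|exact: aP|rewrite -E].
apply: closedI; [|apply: closedI].
- apply: closed_bigI => i _; apply: preimage_closed; last exact: closed_ge.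
  by move=> a _; exact: proj_cont.
- apply: closed_bigI => i _; apply: preimage_closed; last exact: closed_eq.
  by move=> a _; exact: proj_cont.
- apply: preimage_closed; last exact: closed_eq.
  by move=> a _; exact: continuous_lin_comb.
Qed.

(** * Separation from a convex hull, then by a price vector *)

(** First-order optimality at the end of a segment: the hypothesis says that a squared distance does
    not decrease along it, and [2 * A] is its derivative at [t = 0]. *)
Lemma quadratic_ge0_linear_ge0 (R : realFieldType) (A B : R) :
  0 <= B -> (forall t, 0 <= t <= 1 -> 0 <= t * (2 * A + t * B)) -> 0 <= A.
Proof.
move=> B0 h; rewrite leNgt; apply/negP => A0.
have C0 : 0 < B - A by lra.
(* This [t] lies in ]0, 1] and gives [2 * A + t * B = (1 + t) * A], which is negative. *)
pose t := - A / (B - A).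
have tC : t * (B - A) = - A by rewrite /t divfK// gt_eqF.
have t0 : 0 < t by rewrite divr_gt0// oppr_gt0.
have t1 : t <= 1 by rewrite ler_pdivrMr// mul1r; lra.
have := h t; rewrite t1 (ltW t0) => /(_ isT).
rewrite pmulr_rge0//; nra.
Qed.

(* The separating vector is the difference between the point of the convex hull
   nearest to [x] and [x]. *)
Lemma convex_hull_separation (R : realType) (I V : finType) (P : pred I)
    (w : I -> V -> R) (x : V -> R) (i0 : I) : P i0 ->
  (exists2 a, simplex_on R I P a & forall e, \sum_i a i * w i e = x e) \/
  (exists q : V -> R,
     forall i, P i -> \sum_e q e * x e < \sum_e q e * w i e).
Proof.
move=> Pi0.
pose marg (a : I -> R) e := \sum_i a i * w i e.
pose dist2 (a : I -> R) := \sum_e (marg a e - x e) ^+ 2.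
have vertex i : P i -> simplex_on R I P (fun j => (j == i)%:R).
  move=> Pi; split=> [j|j|]; first exact: ler0n.
    by case: eqP => // -> /negP.
  by rewrite (bigD1 i)//= eqxx big1 ?addr0// => j /negbTE ->.
have sqr_dist_cont (T : topologicalType) (F : T -> R) c :
    continuous F -> continuous (fun a => (F a - c) ^+ 2).
  move=> F_cont a; under eq_fun do rewrite expr2.
  by apply: cvgM; (apply: cvgB; [exact: F_cont|exact: cvg_cst]).
have dist2_cont : continuous (dist2 :
    fun_space I R -> R).
  apply: continuous_big => [|e _]; first exact: add_continuous.
  apply: (sqr_dist_cont (fun_space I R)
    (fun a => marg a e)).
  exact: continuous_lin_comb.
have [a /set_mem [a0 aP a1] amin] :=
  @compact_EVT_min (fun_space I R) R
  dist2 (simplex_on R I P) (ex_intro _ _ (vertex i0 Pi0))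
  (@simplex_on_compact R I P) (continuous_subspaceT dist2_cont).
have [margx|/existsNP[e0 /eqP margx]] :=
  pselect (forall e, marg a e = x e).
  by left; exists a.
right; exists (fun e => marg a e - x e) => i Pi.
set q := fun e => marg a e - x e.
have qq : 0 < \sum_e q e ^+ 2.
  rewrite (bigD1 e0)//= ltr_wpDr//; last by rewrite exprn_even_gt0//= subr_eq0.
  by apply: sumr_ge0 => e _; exact: sqr_ge0.
(* Moving from the minimizer [a] towards the vertex at [i] cannot decrease the distance to [x]. *)
have deriv_ge0 : 0 <= \sum_e q e * (w i e - marg a e).
  apply: (@quadratic_ge0_linear_ge0 _ _ (\sum_e (w i e - marg a e) ^+ 2)).
    by apply: sumr_ge0 => e _; exact: sqr_ge0.
  move=> t /andP[t0 t1].
  pose at_ j := (1 - t) * a j + t * (j == i)%:R.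
  have atE e : marg at_ e = marg a e + t * (w i e - marg a e).
    rewrite /marg /at_.
    under eq_bigr => j _ do rewrite mulrDl -!mulrA.
    rewrite big_split/= -!mulr_sumr [X in _ + t * X](bigD1 i)//= eqxx.
    rewrite [X in _ + t * (_ + X)]big1 ?mul1r; first by ring.
    by move=> j /negbTE ->; rewrite mul0r.
  have /mem_set /amin : simplex_on R I P at_.
    have [v0 vP v1] := vertex i Pi; split=> [j|j Pj|].
    - by rewrite addr_ge0// mulr_ge0// ?subr_ge0.
    - by rewrite /at_ aP// vP// !mulr0 addr0.
    - by rewrite big_split/= -!mulr_sumr a1 v1; ring.
  suff -> : t * (2 * \sum_e q e * (w i e - marg a e) +
      t * \sum_e (w i e - marg a e) ^+ 2) = dist2 at_ - dist2 a.
    by rewrite subr_ge0.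
  rewrite !mulr_sumr -big_split/= mulr_sumr -sumrB.
  by apply: eq_bigr => e _; rewrite atE /q; ring.
rewrite -subr_gt0 -sumrB.
(* Split [w i - x] as [(w i - marg a) + q]; the square of [q] makes the separation strict. *)
have -> : \sum_e (q e * w i e - q e * x e) =
    \sum_e q e * (w i e - marg a e) + \sum_e q e ^+ 2.
  by rewrite -big_split/=; apply: eq_bigr => e _; rewrite /q; ring.
by rewrite ltr_wpDl.
Qed.

Lemma monotone_upclosed_separation (R : realType) (V : finType)
    (F : pred {set V}) (c : R) :
  F [set: V]%SET -> (forall A B : {set V}, A \subset B -> F A -> F B) ->
  c <= 1 ->
  (exists2 a, weights (fun=> c) a & forall S, ~~ F S -> a S = 0) \/
  (exists2 p, prices p & forall S : {set V}, F S -> c < \sum_(j in S) p j).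
Proof.
move=> FT F_up c1.
have ind_sum (g : V -> R) (S : {set V}) :
    \sum_e g e * (e \in S)%:R = \sum_(e in S) g e.
  rewrite [RHS]big_mkcond/=; apply: eq_bigr => e _.
  by case: (e \in S); rewrite ?mulr1 ?mulr0.
have [[a [a0 aF a1] ax]|[q qF]] := @convex_hull_separation R {set V} V F
  (fun S e => (e \in S)%:R) (fun=> c) _ FT.
  left; exists a => //; split => // e.
  rewrite -(ax e) [LHS]big_mkcond/=; apply: eq_bigr => S _.
  by case: (e \in S); rewrite ?mulr1 ?mulr0.
right; pose p e := Num.max (q e) 0.
have p0 e : 0 <= p e by rewrite le_max lexx orbT.
have pF (S : {set V}) : F S -> c * \sum_e p e < \sum_(e in S) p e.
  (* Adding every item with negative [q] to [S] stays in [F], and the [q]-sum over [T] is the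
     [p]-sum over [S] minus the total negative part of [q]. *)
  move=> FS; pose T := S :|: [set e | q e < 0]%SET.
  have /qF : F T by apply: F_up FS; exact: finset.subsetUl.
  rewrite ind_sum -mulr_suml mulrC => qT.
  have -> : \sum_(e in S) p e = \sum_(e in T) q e + \sum_e (p e - q e).
    rewrite [LHS]big_mkcond [X in X + _]big_mkcond -big_split/=.
    apply: eq_bigr => e _; rewrite !inE /p.
    by case: ltP; case: (e \in S) => /=; lra.
  (* Passing from [q] to [p] adds the total negative part on the right but only [c] times it on the
     left. *)
  have : 0 <= (1 - c) * \sum_e (p e - q e).
    rewrite mulr_ge0 ?subr_ge0// sumr_ge0// => e _.
    by rewrite subr_ge0 le_max lexx.
  rewrite sumrB; lra.
(* If the total were 0, the strict inequality [pF] for the full bundle would read [0 < 0]. *)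
have p_gt0 : 0 < \sum_e p e.
  rewrite lt_neqAle sumr_ge0 ?andbT; last by move=> e _.
  apply/negP => /eqP p_eq0; have := pF _ FT.
  by rewrite big_set -p_eq0 mulr0 ltxx.
exists (fun e => p e / \sum_e p e); first split.
- by move=> e; rewrite divr_ge0// ltW.
- by rewrite -mulr_suml divff// gt_eqF.
- by move=> S /pF; rewrite -mulr_suml ltr_pdivlMr.
Qed.

(** * Truncation levels and distributions over bundles *)

(** The gap between [z] and an average of the truncation is the average of the nonnegative gaps
    [z - truncation f z S]; it vanishes exactly when no weight lies on bundles worth less than
    [z]. *)
Lemma concave_extension_truncationP (R : realType) (V : finType)
    (f : {set V} -> R) (x : V -> R) (z : R) :
  (forall e, 0 <= x e <= 1) ->
  concave_extension (truncation f z) x = z <->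
  exists2 a, weights x a & forall S, f S < z -> a S = 0.
Proof.
move=> x01; have [a xa [aE amax]] := concave_extension_max (truncation f z) x01.
have le_z (c : {set V} -> R) : weights x c ->
    z - \sum_S c S * truncation f z S = \sum_S c S * (z - truncation f z S).
  move=> [c1 _ _]; under [RHS]eq_bigr => S _ do rewrite mulrBr.
  by rewrite sumrB -mulr_suml c1 mul1r.
have gap_ge0 S : 0 <= z - truncation f z S by rewrite subr_ge0 ge_min lexx orbT.
split=> [az|[c xc cz]].
  exists a => // S fSz; move: (xa) => [_ _ a0].
  have /eqP := le_z _ xa.
  rewrite -aE az subrr eq_sym psumr_eq0; last by move=> T _; rewrite mulr_ge0.
  move=> /allP/(_ S (mem_index_enum _))/=; rewrite mulf_eq0 => /orP[/eqP//|].
  by rewrite subr_eq0 /truncation (min_l (ltW fSz)) gt_eqF.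
apply/eqP; rewrite eq_le aE -subr_ge0 le_z//.
rewrite sumr_ge0 /=; last first.
  by move=> S _; case: xa => _ _ a0; rewrite mulr_ge0.
apply: le_trans (amax _ xc); rewrite -subr_le0 le_z// big1// => S _.
have [fSz|zfS] := ltP (f S) z; first by rewrite cz// mul0r.
by rewrite /truncation min_r// subrr mulr0.
Qed.

(** The average price of a bundle under [a] is exactly [c], so the bundles of positive weight cannot
    all cost more than [c]. *)
Lemma weights_affordable (R : realType) (V : finType) (c : R) a (p : V -> R) :
  weights (fun=> c) a -> prices p ->
  exists2 S : {set V}, a S != 0 & \sum_(j in S) p j <= c.
Proof.
move=> [a1 ac a0] [p0 p1]; apply: contrapT => noS.
have pS S : a S != 0 -> c < \sum_(j in S) p j.
  by move=> aS; rewrite ltNge; apply/negP => cS; apply: noS; exists S.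
(* Double counting: each item [j] contributes [p j] with total weight [c], and the prices sum to
   1. *)
have cE : c = \sum_S a S * \sum_(j in S) p j.
  under eq_bigr => S _ do rewrite mulr_sumr.
  rewrite (exchange_big_dep xpredT)//=.
  under eq_bigr => j _ do rewrite -mulr_suml ac.
  by rewrite -mulr_sumr p1 mulr1.
have : 0 < \sum_S a S * (\sum_(j in S) p j - c).
  have [S aS] : exists S, a S != 0.
    apply: contrapT => /forallNP aS; have /eqP := a1.
    rewrite big1 1?eq_sym ?oner_eq0//.
    by move=> S _; have /negP := aS S; rewrite negbK => /eqP.
  rewrite (bigD1 S)//= ltr_wpDr//.
    apply: sumr_ge0 => T _; have [->|/pS aT] := eqVneq (a T) 0.
      by rewrite mul0r.
    by rewrite mulr_ge0// subr_ge0 ltW.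
  by rewrite mulr_gt0 ?subr_gt0 ?pS// lt_neqAle eq_sym aS a0.
under eq_bigr => S _ do rewrite mulrBr.
by rewrite sumrB -cE -mulr_suml a1 mul1r subrr ltxx.
Qed.

Theorem lemma3p2 (R : realType) (n m : nat)
    (v : 'I_n -> {set 'I_m} -> R) (b : 'I_n -> R)
    (m_gt0 : (0 < m)%N)
    (v_ge0 : forall (i : 'I_n) (A : {set 'I_m}), 0 <= v i A)
    (v_mono : forall (i : 'I_n) (A B : {set 'I_m}),
       A \subset B -> v i A <= v i B)
    (b_gt0 : forall i : 'I_n, 0 < b i)
    (b_sum : \sum_i b i = 1)
    (i : 'I_n) :
  APS (v i) (b i) =
  sup [set z : R |
    0 <= z /\ concave_extension (truncation (v i) z) (fun _ => b i) = z].
Proof.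
have b0 := ltW (b_gt0 i).
have b1 : b i <= 1.
  rewrite -b_sum (bigD1 i)//= lerDl sumr_ge0// => k _; exact: ltW.
have b01 (e : 'I_m) : 0 <= b i <= 1 by rewrite b0.
(* With at least one item the set of prices is nonempty, so the infimum is attained, at [p]. *)
have V_gt0 : (0 < #|'I_m|)%N by rewrite card_ord.
have [p pp [APSE pmin]] := APS_min V_gt0 b0 (v_ge0 i).
have best_ge q (S : {set 'I_m}) : \sum_(j in S) q j <= b i ->
    v i S <= best_affordable (v i) (b i) q.
  by move=> qS; rewrite /best_affordable (bigmax_sup S).
(* The empty bundle is affordable and values are nonnegative, so the default 0 never exceeds the
   value of the best affordable bundle. *)
have best_ex q : exists2 S : {set 'I_m}, \sum_(j in S) q j <= b i &
    best_affordable (v i) (b i) q = v i S.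
  have s0 : \sum_(j in @finset.set0 'I_m) q j <= b i by rewrite big_set0.
  rewrite /best_affordable.
  have [S qS ->] := @eq_bigmax _ _ _ _ (@finset.set0 'I_m)
    (fun S : {set 'I_m} => \sum_(j in S) q j <= b i) (v i) s0
    (fun S _ => v_ge0 i S).
  by exists S.
(* The share is itself a level, so the supremum is attained there. *)
have APS_level : 0 <= APS (v i) (b i) /\
    concave_extension (truncation (v i) (APS (v i) (b i))) (fun=> b i) =
    APS (v i) (b i).
  split; first by have [S _] := best_ex p; rewrite APSE => ->.
  apply/concave_extension_truncationP => //.
  have [| | |[a ba aF]|[q qq qF]] := @monotone_upclosed_separation R 'I_m
      (fun S => APS (v i) (b i) <= v i S) (b i).
  - by have [S _] := best_ex p; rewrite APSE => ->; rewrite v_mono.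
  - by move=> A B AB /le_trans; apply; exact: v_mono.
  - exact: b1.
  - by exists a => // S; rewrite ltNge; exact: aF.
  (* At the separating prices [q], the best affordable bundle is still worth at least the share, yet
     [qF] makes every such bundle too expensive. *)
  - have [S qS bestE] := best_ex q.
    have : APS (v i) (b i) <= v i S by rewrite APSE -bestE pmin.
    by move=> /qF; rewrite ltNge qS.
apply/eqP; rewrite eq_le; apply/andP; split.
  apply: ub_le_sup => //.
  by have [] := has_sup_truncation_levels (v_ge0 i) b01.
apply: ge_sup; first by exists (APS (v i) (b i)).
move=> z [_ /(concave_extension_truncationP _ _ _ _ _ b01)[a ba az]].
(* At the minimizing prices [p], some bundle of nonzero weight is affordable; by [az] it is worth at
   least [z]. *)
have [S aS pS] := weights_affordable _ _ _ _ _ ba pp.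
rewrite APSE (le_trans _ (best_ge _ _ pS))// leNgt; apply/negP => /az aS0.
by rewrite aS0 eqxx in aS.
Qed.
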